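(* Let $k,\rho,c,\ell,\gamma,q_0>0$ and $0<\varepsilon<1$ be real constants and let $\alpha=\frac{k}{\rho c}$. Suppose that $q_0>\sqrt{\frac{\gamma(1-\varepsilon)\rho\ell k}{2}}$. Then Problem $(P_3)$ (with parameter $q_0$) is equivalent to Problem $(P_2)$ (with parameter $D_0$), in the sense that their solutions $(T,s,r)$ coincide, when $D_0$ is related to $q_0$ by $$D_0=\frac{q_0\sqrt{\pi\alpha}}{k}\operatorname{erf}(\omega)>0,$$ where the coefficient $\omega>0$ is the unique solution, for Problem $(P_3)$, of $$\left[x+\frac{\gamma(1-\varepsilon)k}{2q_0\sqrt{\alpha}}e^{x^2}\right]e^{x^2}=\frac{q_0}{\rho\ell\sqrt{\alpha}},\quad x>0,$$ or, equally, the unique solution, for Problem $(P_2)$, of $$G_2(x)=\frac{D_0c}{\ell\sqrt{\pi}},\quad x>0,\qquad G_2(x)=\frac{1}{F_\infty(x)}\left[x+\frac{\gamma(1-\varepsilon)\sqrt{\pi}}{2D_0}\frac{1}{F_\infty(x)}\right],\quad F_\infty(x)=\frac{e^{-x^2}}{\operatorname{erf}(x)}.$$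
   Context: $\operatorname{erf}(x)=\frac{2}{\sqrt{\pi}}\int_0^x e^{-u^2}\,du$. Common conditions for a triple $(T,s,r)$ with $s(t)<r(t)$ for $t>0$: (i) $T_t-\alpha T_{xx}=0$ for $0<x<s(t)$, $t>0$; (ii) $T(s(t),t)=0$, $t>0$; (iii) $kT_x(s(t),t)=\rho\ell[\varepsilon\dot s(t)+(1-\varepsilon)\dot r(t)]$, $t>0$; (iv) $T_x(s(t),t)(r(t)-s(t))=\gamma$, $t>0$; (v) $s(0)=r(0)=0$. Problem $(P_3)$: (i)–(v) together with $kT_x(0,t)=\frac{q_0}{\sqrt t}$, $t>0$. Under the stated inequality on $q_0$ its solution is, with $\omega$ the unique positive root of the first equation in the claim, $$T(x,t)=-\frac{q_0\sqrt{\pi\alpha}\,\operatorname{erf}(\omega)}{k}\left[1-\frac{\operatorname{erf}\left(\frac{x}{2\sqrt{\alpha t}}\right)}{\operatorname{erf}(\omega)}\right],\quad s(t)=2\omega\sqrt{\alpha t},\quad r(t)=2\nu\sqrt{\alpha t},\quad \nu=\omega+\frac{\gamma k}{2q_0\sqrt{\alpha}}e^{\omega^2}.$$ Problem $(P_2)$: (i)–(v) together with $T(0,t)=-D_0<0$, $t>0$. Its (known) solution is, with $\xi$ the unique positive root of $G_2(x)=\frac{D_0c}{\ell\sqrt{\pi}}$, $$T(x,t)=-D_0\left[1-\frac{\operatorname{erf}\left(\frac{x}{2\sqrt{\alpha t}}\right)}{\operatorname{erf}(\xi)}\right],\quad s(t)=2\xi\sqrt{\alpha t},\quad r(t)=2\mu\sqrt{\alpha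 t},\quad \mu=\xi+\frac{\gamma\sqrt{\pi}}{2D_0}e^{\xi^2}\operatorname{erf}(\xi).$$ In both cases $T$ is considered on $0<x<s(t)$, $t>0$. *)

(* Defs.v *)
From Stdlib Require Import Reals.
From Coquelicot Require Import Coquelicot.
Open Scope R_scope.

Definition erf (x : R) : R := 2 / sqrt PI * RInt (fun u => exp (- u ^ 2)) 0 x.

Definition T_x (T : R -> R -> R) (x t : R) : R := Derive (fun y => T y t) x.
Definition T_xx (T : R -> R -> R) (x t : R) : R := Derive_n (fun y => T y t) 2 x.
Definition T_t (T : R -> R -> R) (x t : R) : R := Derive (fun u => T x u) t.

(* The temperature [T] only matters on the open region 0 < x < s(t), t > 0:
   the values of T and T_x on the fixed face x = 0 and on the free boundary
   x = s(t) are the one-sided limits taken from inside that region. *)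
Record common_conditions (k rho c ell gamma eps : R)
    (T : R -> R -> R) (s r : R -> R) : Prop := {
  front_pos : forall t, 0 < t -> 0 < s t;
  front_lt : forall t, 0 < t -> s t < r t;
  front_derivable : forall t, 0 < t -> ex_derive s t /\ ex_derive r t;
  (* [Derive] is total, so the existence of T_t, T_x and T_xx is required
     separately; [ex_derive_n _ 2] only gives differentiability of T_x. *)
  temp_regular : forall x t, 0 < t -> 0 < x < s t ->
    ex_derive (fun u => T x u) t /\
    ex_derive (fun y => T y t) x /\
    ex_derive_n (fun y => T y t) 2 x;
  heat_equation : forall x t, 0 < t -> 0 < x < s t ->
    T_t T x t - k / (rho * c) * T_xx T x t = 0;
  front_temperature : forall t, 0 < t ->
    filterlim (fun x => T x t) (at_left (s t)) (locally 0);
  front_balance : forall t, 0 < t ->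
    filterlim (fun x => k * T_x T x t) (at_left (s t))
      (locally (rho * ell * (eps * Derive s t + (1 - eps) * Derive r t)));
  mushy_width : forall t, 0 < t ->
    filterlim (fun x => T_x T x t * (r t - s t)) (at_left (s t))
      (locally gamma);
  front_initial : s 0 = 0 /\ r 0 = 0;
  front_initial_cont :
    filterlim s (at_right 0) (locally (s 0)) /\
    filterlim r (at_right 0) (locally (r 0))
}.

Definition solves_P3 (k rho c ell gamma eps q0 : R)
    (T : R -> R -> R) (s r : R -> R) : Prop :=
  common_conditions k rho c ell gamma eps T s r /\
  forall t, 0 < t ->
    filterlim (fun x => k * T_x T x t) (at_right 0) (locally (q0 / sqrt t)).

Definition solves_P2 (k rho c ell gamma eps D0 : R)
    (T : R -> R -> R) (s r : R -> R) : Prop :=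
  common_conditions k rho c ell gamma eps T s r /\
  forall t, 0 < t ->
    filterlim (fun x => T x t) (at_right 0) (locally (- D0)).

Definition root_P3 (k rho c ell gamma eps q0 x : R) : Prop :=
  let alpha := k / (rho * c) in
  0 < x /\
  (x + gamma * (1 - eps) * k / (2 * q0 * sqrt alpha) * exp (x ^ 2)) * exp (x ^ 2)
    = q0 / (rho * ell * sqrt alpha).

Definition F_infty (x : R) : R := exp (- x ^ 2) / erf x.

Definition G2 (gamma eps D0 x : R) : R :=
  1 / F_infty x *
  (x + gamma * (1 - eps) * sqrt PI / (2 * D0) * (1 / F_infty x)).

Definition root_P2 (c ell gamma eps D0 x : R) : Prop :=
  0 < x /\ G2 gamma eps D0 x = D0 * c / (ell * sqrt PI).

Definition temp_P3 (k alpha q0 omega x t : R) : R :=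
  - (q0 * sqrt (PI * alpha) * erf omega / k) *
  (1 - erf (x / (2 * sqrt (alpha * t))) / erf omega).

Definition nu_P3 (k alpha gamma q0 omega : R) : R :=
  omega + gamma * k / (2 * q0 * sqrt alpha) * exp (omega ^ 2).

Definition temp_P2 (alpha D0 xi x t : R) : R :=
  - D0 * (1 - erf (x / (2 * sqrt (alpha * t))) / erf xi).

Definition mu_P2 (gamma D0 xi : R) : R :=
  xi + gamma * sqrt PI / (2 * D0) * exp (xi ^ 2) * erf xi.

Definition front (alpha a t : R) : R := 2 * a * sqrt (alpha * t).

Definition coincide (T1 : R -> R -> R) (s1 r1 : R -> R)
    (T2 : R -> R -> R) (s2 r2 : R -> R) : Prop :=
  (forall t, 0 <= t -> s1 t = s2 t /\ r1 t = r2 t) /\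
  (forall x t, 0 < t -> 0 < x < s1 t -> T1 x t = T2 x t).

Definition self_similar (alpha : R) (T : R -> R -> R) (s r : R -> R) : Prop :=
  exists (f : R -> R) (a b : R), forall t, 0 < t ->
    s t = front alpha a t /\ r t = front alpha b t /\
    forall x, 0 < x < s t -> T x t = f (x / (2 * sqrt (alpha * t))).

(* Main.v *)
(* A self-similar solution has a profile f with f'' = - 2 x f', so
   T = q sqrt(PI alpha) / k * (erf(x / (2 sqrt(alpha t))) - erf a), where q / sqrt t is its
   flux through x = 0. The two conditions on the free boundary then hold exactly when r is
   determined by a and q, and a solves the equation of Problem (P_3) for this q. Multiplying
   that equation by erf a gives the equation of Problem (P_2) for
   D0 = q sqrt(PI alpha) / k * erf a, which is minus the temperature at x = 0. Both
   equations have at most one positive root by monotonicity, so either datum on the face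
   x = 0 fixes a = omega and with it the other datum. *)
Require Import Defs.
From Stdlib Require Import Reals Lra.
From Coquelicot Require Import Coquelicot.
Open Scope R_scope.

(** * The error function: derivative, sign and monotonicity *)

Lemma is_derive_erf (x : R) : is_derive erf x (2 / sqrt PI * exp (- x ^ 2)).
Proof.
unfold erf.
apply (is_derive_scal (fun x => RInt (fun u => exp (- u ^ 2)) 0 x)).
assert (Hc : forall y, continuous (fun u => exp (- u ^ 2)) y).
{ intros y. apply (ex_derive_continuous (fun u => exp (- u ^ 2))). auto_derive. exact I. }
apply (is_derive_RInt (fun u => exp (- u ^ 2)) _ 0).
- apply filter_forall. intros y.
  apply (RInt_correct (fun u => exp (- u ^ 2))).
  apply (ex_RInt_continuous (fun u => exp (- u ^ 2))). intros z _. apply Hc.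
- apply Hc.
Qed.

Lemma sqrt_PI_pos : 0 < sqrt PI.
Proof. apply sqrt_lt_R0, PI_RGT_0. Qed.

Lemma erf_0 : erf 0 = 0.
Proof. unfold erf. rewrite RInt_point. unfold zero; simpl. ring. Qed.

Lemma erf_increasing (x y : R) : x < y -> erf x < erf y.
Proof.
intros Hxy.
destruct (MVT_gen erf x y (fun x => 2 / sqrt PI * exp (- x ^ 2))) as [z [_ Hz]].
- intros z _. apply is_derive_erf.
- intros z _. apply continuity_pt_filterlim, (ex_derive_continuous erf).
  eexists. apply is_derive_erf.
- assert (0 < 2 / sqrt PI * exp (- z ^ 2) * (y - x)); [|lra].
  repeat apply Rmult_lt_0_compat; try lra; try apply exp_pos.
  apply Rinv_0_lt_compat, sqrt_PI_pos.
Qed.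

Lemma erf_pos (x : R) : 0 < x -> 0 < erf x.
Proof. intros Hx. rewrite <- erf_0. now apply erf_increasing. Qed.

Lemma continuous_erf (x : R) : continuous erf x.
Proof. apply (ex_derive_continuous erf). eexists. apply is_derive_erf. Qed.

(** * One-sided limits at the ends of the interval below the front *)

(** Turns a boundary condition stated as a limit from inside into an equation for the value of a
    continuous formula. The forward direction is uniqueness of limits. *)
Lemma at_left_limit_iff (g phi : R -> R) (a b l : R) :
  b < a -> (forall x, b < x < a -> g x = phi x) -> continuous phi a ->
  (filterlim g (at_left a) (locally l) <-> phi a = l).
Proof.
intros Hba Hg Hphi.
assert (Hlim : filterlim g (at_left a) (locally (phi a))).
{ apply (filterlim_ext_loc phi).
  - unfold at_left, within.
    apply (filter_imp (fun x => b < x)).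
    + intros x Hx Hxa. symmetry. apply Hg. lra.
    + now apply open_gt.
  - exact (filterlim_filter_le_1 phi (filter_le_within (F := locally a) _) Hphi). }
split; [|now intros <-].
intros H. exact (filterlim_locally_unique g _ _ Hlim H).
Qed.

Lemma at_right_limit_iff (g phi : R -> R) (a b l : R) :
  a < b -> (forall x, a < x < b -> g x = phi x) -> continuous phi a ->
  (filterlim g (at_right a) (locally l) <-> phi a = l).
Proof.
intros Hab Hg Hphi.
assert (Hlim : filterlim g (at_right a) (locally (phi a))).
{ apply (filterlim_ext_loc phi).
  - unfold at_right, within.
    apply (filter_imp (fun x => x < b)).
    + intros x Hx Hxa. symmetry. apply Hg. lra.
    + now apply open_lt.
  - exact (filterlim_filter_le_1 phi (filter_le_within (F := locally a) _) Hphi). }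
split; [|now intros <-].
intros H. exact (filterlim_locally_unique g _ _ Hlim H).
Qed.

Lemma locally_between (a b x : R) : a < x < b -> locally x (fun y => a < y < b).
Proof.
intros [Ha Hb]. apply filter_and; [now apply open_gt | now apply open_lt].
Qed.

(** * Square-root fronts and the similarity variable *)

Lemma is_derive_front (alpha a t : R) : 0 < alpha -> 0 < t ->
  is_derive (front alpha a) t (a * sqrt alpha / sqrt t).
Proof.
intros Halpha Ht.
assert (Hs := sqrt_lt_R0 _ Halpha). assert (Hst := sqrt_lt_R0 _ Ht).
unfold front. auto_derive.
- now apply Rmult_lt_0_compat.
- rewrite sqrt_mult by lra.
  replace alpha with (sqrt alpha * sqrt alpha) at 1 by (apply sqrt_sqrt; lra).
  field. lra.
Qed.

Lemma continuous_front (alpha a t : R) : continuous (front alpha a) t.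
Proof.
unfold front. apply (continuous_mult (fun _ => 2 * a) (fun t => sqrt (alpha * t))).
- apply continuous_const.
- apply (continuous_comp (fun t => alpha * t) sqrt).
  + apply (continuous_mult (fun _ => alpha) (fun t => t)).
    * apply continuous_const.
    * apply continuous_id.
  + apply continuous_sqrt.
Qed.

(** Continuity of the front keeps a fixed [x] below it at nearby times. This is what allows
    differentiation in time of a [T] known only below the front. *)
Lemma locally_below_front (alpha a x t : R) : 0 < t -> 0 < x < front alpha a t ->
  locally t (fun u => 0 < u /\ 0 < x < front alpha a u).
Proof.
intros Ht [Hx Hxt].
apply filter_and; [now apply open_gt|].
apply filter_and; [now apply filter_forall|].
apply (continuous_front alpha a t). now apply open_gt.
Qed.

Lemma similarity_lt (alpha a x t : R) : 0 < alpha -> 0 < t -> 0 < x < front alpha a t ->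
  0 < x / (2 * sqrt (alpha * t)) < a.
Proof.
intros Halpha Ht [Hx Hxt]. unfold front in Hxt.
assert (Hs : 0 < sqrt (alpha * t)) by (apply sqrt_lt_R0; now apply Rmult_lt_0_compat).
split.
- apply Rdiv_lt_0_compat; lra.
- apply Rmult_lt_reg_r with (2 * sqrt (alpha * t)); [lra|].
  unfold Rdiv. rewrite Rmult_assoc, Rinv_l by lra. lra.
Qed.

(* The amplitude is normalised by the flux: [k T_x = q / sqrt t] at [x = 0]. *)
Definition erf_temp (k alpha q a x t : R) : R :=
  q * sqrt (PI * alpha) / k * (erf (x / (2 * sqrt (alpha * t))) - erf a).

Definition erf_flux (k alpha q x t : R) : R :=
  q / (k * sqrt t) * exp (- (x / (2 * sqrt (alpha * t))) ^ 2).

(** * Partial derivatives of the erf profile *)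

Lemma is_derive_scal_shift (g : R -> R) (K c x l : R) :
  is_derive g x l -> is_derive (fun y => K * (g y - c)) x (K * l).
Proof.
intros H. auto_derive.
- eexists; exact H.
- replace (Derive _ x) with l by (symmetry; now apply is_derive_unique). ring.
Qed.

(** By the chain rule, [sqrt PI * sqrt alpha] from the amplitude cancels against [2 / sqrt PI] and
    the inner derivative [1 / (2 * sqrt (alpha * t))]. *)
Lemma is_derive_erf_temp_x (k alpha q a x t : R) : 0 < k -> 0 < alpha -> 0 < t ->
  is_derive (fun y => erf_temp k alpha q a y t) x (erf_flux k alpha q x t).
Proof.
intros Hk Halpha Ht.
assert (Hs := sqrt_lt_R0 _ Halpha). assert (Hst := sqrt_lt_R0 _ Ht).
assert (Hpi := sqrt_PI_pos). assert (HPI := PI_RGT_0).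
unfold erf_temp, erf_flux. rewrite !sqrt_mult by lra.
set (m := 2 * (sqrt alpha * sqrt t)).
assert (Hm : 0 < m) by (unfold m; repeat apply Rmult_lt_0_compat; lra).
assert (H : is_derive (fun y => erf (y / m)) x (/ m * (2 / sqrt PI * exp (- (x / m) ^ 2)))).
{ apply (is_derive_comp erf (fun y => y / m)).
  - apply is_derive_erf.
  - auto_derive; [exact I|]. field. lra. }
replace (_ * exp _) with
  (q * (sqrt PI * sqrt alpha) / k * (/ m * (2 / sqrt PI * exp (- (x / m) ^ 2))))
  by (unfold m; field; repeat split; lra).
now apply is_derive_scal_shift.
Qed.

Lemma is_derive_erf_flux_x (k alpha q x t : R) : 0 < k -> 0 < alpha -> 0 < t ->
  is_derive (fun y => erf_flux k alpha q y t) x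
    (- (x / (2 * alpha * t)) * erf_flux k alpha q x t).
Proof.
intros Hk Halpha Ht.
assert (Hs := sqrt_lt_R0 _ Halpha). assert (Hst := sqrt_lt_R0 _ Ht).
unfold erf_flux. rewrite !sqrt_mult by lra.
replace (2 * alpha * t) with (2 * (sqrt alpha * sqrt alpha) * (sqrt t * sqrt t))
  by (rewrite !sqrt_sqrt; lra).
auto_derive; [exact I|].
simpl. unfold Rdiv. field. repeat split; lra.
Qed.

(** The result is [alpha] times the second space derivative given by [is_derive_erf_flux_x], so the
    profile solves the heat equation for every [q] and [a]. *)
Lemma is_derive_erf_temp_t (k alpha q a x t : R) : 0 < k -> 0 < alpha -> 0 < t ->
  is_derive (fun u => erf_temp k alpha q a x u) t
    (- (x / (2 * t)) * erf_flux k alpha q x t).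
Proof.
intros Hk Halpha Ht.
assert (Hs := sqrt_lt_R0 _ Halpha). assert (Hst := sqrt_lt_R0 _ Ht).
assert (Hpi := sqrt_PI_pos). assert (HPI := PI_RGT_0).
assert (Hat : 0 < alpha * t) by now apply Rmult_lt_0_compat.
assert (H : is_derive (fun u => erf (x / (2 * sqrt (alpha * u)))) t
  (- (x / (2 * sqrt (alpha * t))) / (2 * t) *
    (2 / sqrt PI * exp (- (x / (2 * sqrt (alpha * t))) ^ 2)))).
{ apply (is_derive_comp erf (fun u => x / (2 * sqrt (alpha * u)))).
  - apply is_derive_erf.
  - auto_derive; rewrite ?sqrt_mult by lra.
    + split; [exact Hat|]. split; [|exact I].
      assert (0 < sqrt alpha * sqrt t) by now apply Rmult_lt_0_compat.
      lra.
    (* Writing [alpha] and [t] as squares of their roots leaves a rational identity in [A] and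
       [B]. *)
    + set (A := sqrt alpha) in *. set (B := sqrt t) in *.
      replace alpha with (A * A) by (apply sqrt_sqrt; lra).
      replace t with (B * B) by (apply sqrt_sqrt; lra).
      field. lra. }
unfold erf_temp, erf_flux.
apply (is_derive_scal_shift _ (q * sqrt (PI * alpha) / k) (erf a)) in H.
match type of H with is_derive _ _ ?l => replace (- (x / (2 * t)) * _) with l end; [exact H|].
rewrite !sqrt_mult by lra. field. repeat split; lra.
Qed.

(** * Boundary conditions of an erf solution as equations in [q], [a], [b] *)

(** The general candidate before any condition on the front or the face is imposed except zero front
    temperature: [q], [a] and [b] are still unrelated. *)
Definition erf_solution (k alpha q a b : R) (T : R -> R -> R) (s r : R -> R) : Prop :=
  0 < a /\
  (forall t, 0 < t -> s t = front alpha a t /\ r t = front alpha b t) /\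
  (forall x t, 0 < t -> 0 < x < s t -> T x t = erf_temp k alpha q a x t).

Lemma front_gt0 (alpha a t : R) : 0 < alpha -> 0 < a -> 0 < t -> 0 < front alpha a t.
Proof.
intros Halpha Ha Ht. unfold front.
apply Rmult_lt_0_compat; [lra|]. apply sqrt_lt_R0. now apply Rmult_lt_0_compat.
Qed.

Lemma front_similarity (alpha a t : R) : 0 < alpha -> 0 < t ->
  front alpha a t / (2 * sqrt (alpha * t)) = a.
Proof.
intros Halpha Ht. unfold front.
assert (0 < sqrt (alpha * t)) by (apply sqrt_lt_R0; now apply Rmult_lt_0_compat).
field. lra.
Qed.

Lemma T_x_agree (k alpha q a : R) (T : R -> R -> R) (x t b : R) :
  0 < k -> 0 < alpha -> 0 < t -> 0 < x < b ->
  (forall y, 0 < y < b -> T y t = erf_temp k alpha q a y t) ->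
  is_derive (fun y => T y t) x (erf_flux k alpha q x t).
Proof.
intros Hk Halpha Ht Hx HT.
apply (is_derive_ext_loc (fun y => erf_temp k alpha q a y t)).
- apply (filter_imp (fun y => 0 < y < b)).
  + intros y Hy. symmetry. now apply HT.
  + now apply locally_between.
- now apply is_derive_erf_temp_x.
Qed.

Lemma erf_solution_T_x (k alpha q a b : R) (T : R -> R -> R) (s r : R -> R) (x t : R) :
  0 < k -> 0 < alpha -> erf_solution k alpha q a b T s r ->
  0 < t -> 0 < x < s t -> T_x T x t = erf_flux k alpha q x t.
Proof.
intros Hk Halpha [_ [_ HT]] Ht Hx.
apply is_derive_unique, T_x_agree with a (s t); auto.
Qed.

Lemma continuous_erf_temp_x (k alpha q a x t : R) : 0 < k -> 0 < alpha -> 0 < t ->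
  continuous (fun y => erf_temp k alpha q a y t) x.
Proof.
intros Hk Halpha Ht. apply (ex_derive_continuous (fun y => erf_temp k alpha q a y t)).
eexists. now apply is_derive_erf_temp_x.
Qed.

Lemma continuous_erf_flux_scal (k alpha q m x t : R) : 0 < k -> 0 < alpha -> 0 < t ->
  continuous (fun y => m * erf_flux k alpha q y t) x.
Proof.
intros Hk Halpha Ht. apply (ex_derive_continuous (fun y => m * erf_flux k alpha q y t)).
apply (ex_derive_scal (fun y => erf_flux k alpha q y t)).
eexists. now apply is_derive_erf_flux_x.
Qed.

Lemma erf_flux_front (k alpha q a t : R) : 0 < alpha -> 0 < t ->
  erf_flux k alpha q (front alpha a t) t = q / (k * sqrt t) * exp (- a ^ 2).
Proof. intros Halpha Ht. unfold erf_flux. now rewrite front_similarity. Qed.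

Lemma erf_solution_front_temperature (k alpha q a b : R) (T : R -> R -> R) (s r : R -> R) (t : R) :
  0 < k -> 0 < alpha -> erf_solution k alpha q a b T s r -> 0 < t ->
  filterlim (fun x => T x t) (at_left (s t)) (locally 0).
Proof.
intros Hk Halpha [Ha [Hsr HT]] Ht. destruct (Hsr t Ht) as [Hs _].
apply (at_left_limit_iff _ (fun y => erf_temp k alpha q a y t) _ 0).
- rewrite Hs. now apply front_gt0.
- intros x Hx. now apply HT.
- now apply continuous_erf_temp_x.
- rewrite Hs. unfold erf_temp. rewrite front_similarity by assumption. ring.
Qed.

(** The flux scales as [1 / sqrt t] and the width as [sqrt t], so their product is independent of
    time and the condition at any one [t] is the same equation. *)
Lemma erf_solution_mushy_width (k alpha q a b gamma : R)
    (T : R -> R -> R) (s r : R -> R) (t : R) :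
  0 < k -> 0 < alpha -> erf_solution k alpha q a b T s r -> 0 < t ->
  (filterlim (fun x => T_x T x t * (r t - s t)) (at_left (s t)) (locally gamma) <->
   2 * q * sqrt alpha * (b - a) * exp (- a ^ 2) = gamma * k).
Proof.
intros Hk Halpha Hsol Ht. assert (Hsol' := Hsol).
destruct Hsol' as [Ha [Hsr HT]]. destruct (Hsr t Ht) as [Hs Hr].
rewrite (at_left_limit_iff _ (fun y => (r t - s t) * erf_flux k alpha q y t) _ 0).
- rewrite Hs, Hr, erf_flux_front by assumption. unfold front.
  rewrite sqrt_mult by lra.
  assert (Hst := sqrt_lt_R0 _ Ht).
  replace ((2 * b * (sqrt alpha * sqrt t) - 2 * a * (sqrt alpha * sqrt t)) *
    (q / (k * sqrt t) * exp (- a ^ 2)))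
    with (2 * q * sqrt alpha * (b - a) * exp (- a ^ 2) / k) by (field; lra).
  split; [intros <- | intros ->]; field; lra.
- rewrite Hs. now apply front_gt0.
- intros x Hx. rewrite (erf_solution_T_x k alpha q a b T s r) by assumption. ring.
- now apply continuous_erf_flux_scal.
Qed.

Lemma erf_solution_front_derive (k alpha q a b : R) (T : R -> R -> R) (s r : R -> R) (t : R) :
  0 < alpha -> erf_solution k alpha q a b T s r -> 0 < t ->
  is_derive s t (a * sqrt alpha / sqrt t) /\ is_derive r t (b * sqrt alpha / sqrt t).
Proof.
intros Halpha [_ [Hsr _]] Ht.
assert (Hloc := open_gt 0 t Ht).
split; (eapply is_derive_ext_loc; [|now apply is_derive_front]);
  (eapply filter_imp; [|exact Hloc]); intros u Hu; symmetry; now apply Hsr.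
Qed.

(** Flux and front velocities both scale as [1 / sqrt t]; cancelling this factor removes time. *)
Lemma erf_solution_front_balance (k alpha q a b rho ell eps : R)
    (T : R -> R -> R) (s r : R -> R) (t : R) :
  0 < k -> 0 < alpha -> erf_solution k alpha q a b T s r -> 0 < t ->
  (filterlim (fun x => k * T_x T x t) (at_left (s t))
     (locally (rho * ell * (eps * Derive s t + (1 - eps) * Derive r t))) <->
   q * exp (- a ^ 2) = rho * ell * sqrt alpha * (eps * a + (1 - eps) * b)).
Proof.
intros Hk Halpha Hsol Ht. assert (Hsol' := Hsol).
destruct Hsol' as [Ha [Hsr HT]]. destruct (Hsr t Ht) as [Hs _].
destruct (erf_solution_front_derive _ _ _ _ _ _ _ _ t Halpha Hsol Ht) as [Ds Dr].
rewrite (is_derive_unique _ _ _ Ds), (is_derive_unique _ _ _ Dr).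
rewrite (at_left_limit_iff _ (fun y => k * erf_flux k alpha q y t) _ 0).
- rewrite Hs, erf_flux_front by assumption.
  assert (Hst := sqrt_lt_R0 _ Ht).
  replace (k * (q / (k * sqrt t) * exp (- a ^ 2)))
    with (q * exp (- a ^ 2) / sqrt t) by (field; lra).
  replace (rho * ell * _)
    with (rho * ell * sqrt alpha * (eps * a + (1 - eps) * b) / sqrt t) by (field; lra).
  split; [|now intros ->]. intros H.
  apply (f_equal (fun y => y * sqrt t)) in H.
  unfold Rdiv in H. rewrite !Rmult_assoc, Rinv_l, !Rmult_1_r in H by lra.
  rewrite H. ring.
- rewrite Hs. now apply front_gt0.
- intros x Hx. now rewrite (erf_solution_T_x k alpha q a b T s r) by assumption.
- now apply continuous_erf_flux_scal.
Qed.

Lemma erf_solution_face_flux (k alpha q a b q0 : R) (T : R -> R -> R) (s r : R -> R) (t : R) :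
  0 < k -> 0 < alpha -> erf_solution k alpha q a b T s r -> 0 < t ->
  (filterlim (fun x => k * T_x T x t) (at_right 0) (locally (q0 / sqrt t)) <-> q = q0).
Proof.
intros Hk Halpha Hsol Ht. assert (Hsol' := Hsol).
destruct Hsol' as [Ha [Hsr _]]. destruct (Hsr t Ht) as [Hs _].
rewrite (at_right_limit_iff _ (fun y => k * erf_flux k alpha q y t) _ (s t)).
- assert (Hst := sqrt_lt_R0 _ Ht).
  unfold erf_flux. replace (- (0 / _) ^ 2) with 0 by (unfold Rdiv; ring).
  rewrite exp_0.
  replace (k * (q / (k * sqrt t) * 1)) with (q / sqrt t) by (field; lra).
  split; [|now intros ->]. intros H.
  apply (Rmult_eq_reg_r (/ sqrt t)); [exact H|].
  apply Rinv_neq_0_compat; lra.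
- rewrite Hs. now apply front_gt0.
- intros x Hx. now rewrite (erf_solution_T_x k alpha q a b T s r) by assumption.
- now apply continuous_erf_flux_scal.
Qed.

Lemma erf_solution_face_temperature (k alpha q a b D0 : R)
    (T : R -> R -> R) (s r : R -> R) (t : R) :
  0 < k -> 0 < alpha -> erf_solution k alpha q a b T s r -> 0 < t ->
  (filterlim (fun x => T x t) (at_right 0) (locally (- D0)) <->
   q * sqrt (PI * alpha) / k * erf a = D0).
Proof.
intros Hk Halpha [Ha [Hsr HT]] Ht. destruct (Hsr t Ht) as [Hs _].
rewrite (at_right_limit_iff _ (fun y => erf_temp k alpha q a y t) _ (s t)).
- unfold erf_temp. replace (0 / _) with 0 by (unfold Rdiv; ring).
  rewrite erf_0. split; intros; lra.
- rewrite Hs. now apply front_gt0.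
- intros x Hx. now apply HT.
- now apply continuous_erf_temp_x.
Qed.

(** * Common conditions and the front system; classification of self-similar solutions *)

Definition front_system (k alpha rho ell gamma eps q a b : R) : Prop :=
  2 * q * sqrt alpha * (b - a) * exp (- a ^ 2) = gamma * k /\
  q * exp (- a ^ 2) = rho * ell * sqrt alpha * (eps * a + (1 - eps) * b).

(** The reduced equations do not contain [t], so it is enough to read the conditions at [t = 1]. *)
Lemma front_system_of_erf_solution (k rho c ell gamma eps q a b : R)
    (T : R -> R -> R) (s r : R -> R) :
  let alpha := k / (rho * c) in
  0 < k -> 0 < alpha -> erf_solution k alpha q a b T s r ->
  common_conditions k rho c ell gamma eps T s r ->
  front_system k alpha rho ell gamma eps q a b /\ a < b.
Proof.
intros alpha Hk Halpha Hsol HC. split; [split|].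
- apply (erf_solution_mushy_width k alpha q a b gamma T s r 1); try assumption; try lra.
  apply HC; lra.
- apply (erf_solution_front_balance k alpha q a b rho ell eps T s r 1); try assumption; try lra.
  apply HC; lra.
- assert (H := front_lt _ _ _ _ _ _ _ _ _ HC 1 Rlt_0_1).
  destruct Hsol as [_ [Hsr _]]. destruct (Hsr 1 Rlt_0_1) as [Hs Hr].
  rewrite Hs, Hr in H. unfold front in H.
  assert (0 < sqrt (alpha * 1)) by (apply sqrt_lt_R0; lra).
  apply Rmult_lt_reg_r with (2 * sqrt (alpha * 1)); lra.
Qed.

Lemma front_0 (alpha a : R) : front alpha a 0 = 0.
Proof. unfold front. rewrite Rmult_0_r, sqrt_0. ring. Qed.

Lemma filterlim_front_0 (alpha a : R) :
  filterlim (front alpha a) (at_right 0) (locally (front alpha a 0)).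
Proof.
apply (at_right_limit_iff _ (front alpha a) 0 1); auto using continuous_front. lra.
Qed.

Lemma common_conditions_of_system (k rho c ell gamma eps q a b : R)
    (T : R -> R -> R) :
  let alpha := k / (rho * c) in
  0 < k -> 0 < alpha -> a < b ->
  erf_solution k alpha q a b T (front alpha a) (front alpha b) ->
  front_system k alpha rho ell gamma eps q a b ->
  common_conditions k rho c ell gamma eps T (front alpha a) (front alpha b).
Proof.
intros alpha Hk Halpha Hab Hsol [Hmushy Hbal].
assert (Ha : 0 < a) by apply Hsol.
assert (HT : forall x t, 0 < t -> 0 < x < front alpha a t ->
  T x t = erf_temp k alpha q a x t) by apply Hsol.
assert (Dx : forall x t, 0 < t -> 0 < x < front alpha a t ->
  is_derive (fun y => T y t) x (erf_flux k alpha q x t)).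
{ intros x t Ht Hx. apply T_x_agree with a (front alpha a t); auto. }
(* The second derivative is that of the map [Derive], which equals [erf_flux] on a whole
   neighbourhood of [x], not only at [x]. *)
assert (Dxx : forall x t, 0 < t -> 0 < x < front alpha a t ->
  is_derive (fun y => Derive (fun z => T z t) y) x
    (- (x / (2 * alpha * t)) * erf_flux k alpha q x t)).
{ intros x t Ht Hx.
  apply (is_derive_ext_loc (fun y => erf_flux k alpha q y t)).
  - apply (filter_imp (fun y => 0 < y < front alpha a t)).
    + intros y Hy. symmetry. apply is_derive_unique. now apply Dx.
    + now apply locally_between.
  - now apply is_derive_erf_flux_x. }
assert (Dt : forall x t, 0 < t -> 0 < x < front alpha a t ->
  is_derive (fun u => T x u) t (- (x / (2 * t)) * erf_flux k alpha q x t)).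
{ intros x t Ht Hx.
  apply (is_derive_ext_loc (fun u => erf_temp k alpha q a x u)).
  - eapply filter_imp; [|now apply (locally_below_front alpha a x t)].
    intros u [Hu Hxu]. symmetry. now apply HT.
  - now apply is_derive_erf_temp_t. }
constructor.
- intros t Ht. now apply front_gt0.
- intros t Ht. unfold front.
  assert (0 < sqrt (alpha * t)) by (apply sqrt_lt_R0; now apply Rmult_lt_0_compat).
  apply Rmult_lt_compat_r; lra.
- intros t Ht. split; eexists; now apply is_derive_front.
- intros x t Ht Hx. repeat split.
  + eexists. now apply Dt.
  + eexists. now apply Dx.
  + eexists. now apply Dxx.
- intros x t Ht Hx. unfold T_t, T_xx. fold alpha.
  replace (Derive (fun u => T x u) t) with (- (x / (2 * t)) * erf_flux k alpha q x t)
    by (symmetry; now apply is_derive_unique, Dt).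
  replace (Derive_n _ 2 x) with (- (x / (2 * alpha * t)) * erf_flux k alpha q x t)
    by (symmetry; now apply is_derive_unique, Dxx).
  field. lra.
- intros t Ht. exact (erf_solution_front_temperature _ _ _ _ _ _ _ _ t Hk Halpha Hsol Ht).
- intros t Ht. now apply (erf_solution_front_balance k alpha q a b).
- intros t Ht. now apply (erf_solution_mushy_width k alpha q a b).
- split; apply front_0.
- split; apply filterlim_front_0.
Qed.

(* At [t = 1 / (4 alpha)] the similarity variable is [x] itself, so the profile is [T] at
   that time and the heat equation becomes the ODE [f'' = - 2 x f']. *)
Lemma erf_solution_of_self_similar (k rho c ell gamma eps : R)
    (T : R -> R -> R) (s r : R -> R) :
  let alpha := k / (rho * c) in
  0 < k -> 0 < alpha -> self_similar alpha T s r ->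
  common_conditions k rho c ell gamma eps T s r ->
  exists q a b, erf_solution k alpha q a b T s r.
Proof.
intros alpha Hk Halpha [f [a [b Hf]]] HC.
set (t0 := / (4 * alpha)).
assert (Ht0 : 0 < t0) by (apply Rinv_0_lt_compat; lra).
assert (Hsim0 : 2 * sqrt (alpha * t0) = 1).
{ replace (alpha * t0) with ((1 / 2) * (1 / 2)) by (unfold t0; field; lra).
  rewrite sqrt_square; lra. }
assert (Hs0 : s t0 = a).
{ destruct (Hf t0 Ht0) as [-> _]. unfold front.
  replace (2 * a * _) with (a * (2 * sqrt (alpha * t0))) by ring. rewrite Hsim0. ring. }
assert (Ha : 0 < a) by (rewrite <- Hs0; now apply (front_pos _ _ _ _ _ _ _ _ _ HC)).
(* Nothing is known about the regularity of [f] itself; [g] agrees with it on [(0, a)] and inherits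
   the regularity of [T] there. *)
pose (g := fun y => T y t0).
assert (Hg : forall y, 0 < y < a -> f y = g y).
{ intros y Hy. destruct (Hf t0 Ht0) as [_ [_ H]].
  unfold g. rewrite (H y) by now rewrite Hs0. rewrite Hsim0. f_equal. field. }
assert (HTg : forall x t, 0 < t -> 0 < x < s t ->
  T x t = g (x / (2 * sqrt (alpha * t)))).
{ intros x t Ht Hx. destruct (Hf t Ht) as [Hs [_ H]].
  rewrite (H x Hx). apply Hg. apply similarity_lt; try assumption. now rewrite <- Hs. }
assert (Dg : forall x, 0 < x < a -> is_derive g x (Derive g x)).
{ intros x Hx. apply Derive_correct.
  apply (temp_regular _ _ _ _ _ _ _ _ _ HC x t0 Ht0). now rewrite Hs0. }
assert (DDg : forall x, 0 < x < a -> is_derive (Derive g) x (- 2 * x * Derive g x)).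
{ intros x Hx.
  assert (Hx0 : 0 < x < s t0) by now rewrite Hs0.
  destruct (temp_regular _ _ _ _ _ _ _ _ _ HC x t0 Ht0 Hx0) as [_ [_ Hxx]].
  assert (Heq := heat_equation _ _ _ _ _ _ _ _ _ HC x t0 Ht0 Hx0).
  fold alpha in Heq. unfold T_t, T_xx in Heq.
  change (Derive_n (fun y => T y t0) 2 x) with (Derive (Derive g) x) in Heq.
  (* At [t0] the similarity variable has time derivative [- x / (2 * t0)], which is
     [- 2 * alpha * x]. *)
  assert (Dt : is_derive (fun u => T x u) t0 (- (2 * alpha * x) * Derive g x)).
  { apply (is_derive_ext_loc (fun u => g (x / (2 * sqrt (alpha * u))))).
    - apply (filter_imp (fun u => 0 < u /\ 0 < x < front alpha a u)).
      + intros u [Hu Hxu]. symmetry. apply HTg; [exact Hu|].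
        destruct (Hf u Hu) as [Hs _]. now rewrite Hs.
      + apply locally_below_front; [exact Ht0|].
        destruct (Hf t0 Ht0) as [Hs _]. now rewrite <- Hs.
    - apply (is_derive_comp g (fun u => x / (2 * sqrt (alpha * u)))).
      + rewrite Hsim0. replace (x / 1) with x by field. now apply Dg.
      + assert (Hat : 0 < alpha * t0) by now apply Rmult_lt_0_compat.
        auto_derive.
        * rewrite Hsim0. repeat split; lra.
        * replace (sqrt (alpha * t0)) with (1 / 2) by lra. field. }
  replace (Derive (fun u => T x u) t0) with (- (2 * alpha * x) * Derive g x) in Heq
    by (symmetry; now apply is_derive_unique).
  replace (- 2 * x * Derive g x) with (Derive (Derive g) x).
  - apply Derive_correct. exact Hxx.
  - apply Rmult_eq_reg_l with alpha; lra. }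
(* [exp (y ^ 2)] is the integrating factor of [g'' = - 2 x g'], so [h] is constant. [K] is chosen so
   that [K * erf] has the same derivative as [g]; the midpoint [a / 2] is only a reference point in
   the interval. *)
pose (h := fun y => Derive g y * exp (y ^ 2)).
pose (K := h (a / 2) * sqrt PI / 2).
assert (Hconst : forall (u : R -> R), (forall x, 0 < x < a -> is_derive u x 0) ->
  forall x, 0 < x < a -> u x = u (a / 2)).
{ intros u Hu x Hx. destruct (Rtotal_order x (a / 2)) as [H|[->|H]]; [|reflexivity|].
  - apply (eq_is_derive u x (a / 2)); [|exact H]. intros y Hy. apply Hu; lra.
  - symmetry. apply (eq_is_derive u (a / 2) x); [|exact H]. intros y Hy. apply Hu; lra. }
assert (Hh : forall x, 0 < x < a -> h x = h (a / 2)).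
{ apply Hconst. intros x Hx. unfold h.
  replace 0 with ((- 2 * x * Derive g x) * exp (x ^ 2) + Derive g x * (2 * x * exp (x ^ 2)))
    by ring.
  apply (is_derive_mult (Derive g) (fun y => exp (y ^ 2))).
  - now apply DDg.
  - auto_derive; [exact I|]. simpl. ring.
  - intros; apply Rmult_comm. }
assert (Hprof : forall x, 0 < x < a -> g x - K * erf x = g (a / 2) - K * erf (a / 2)).
{ apply (Hconst (fun x => g x - K * erf x)). intros x Hx.
  replace 0 with (Derive g x - K * (2 / sqrt PI * exp (- x ^ 2))).
  - apply (is_derive_minus g (fun x => K * erf x)); [now apply Dg|].
    apply (is_derive_scal erf), is_derive_erf.
  - unfold K. rewrite <- (Hh x Hx). unfold h. rewrite exp_Ropp.
    assert (Hpi := sqrt_PI_pos). assert (He := exp_pos (x ^ 2)).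
    field. split; lra. }
set (m := g (a / 2) - K * erf (a / 2)) in Hprof.
(* The zero temperature at the front fixes the constant of integration. *)
assert (Hm : K * erf a + m = 0).
{ apply (at_left_limit_iff g (fun x => K * erf x + m) a 0).
  - exact Ha.
  - intros x Hx. rewrite <- (Hprof x Hx). ring.
  - apply (continuous_plus (fun x => K * erf x) (fun _ => m)).
    + apply (continuous_mult (fun _ => K) erf); [apply continuous_const|].
      apply continuous_erf.
    + apply continuous_const.
  - rewrite <- Hs0. now apply (front_temperature _ _ _ _ _ _ _ _ _ HC). }
assert (Hpa : 0 < sqrt (PI * alpha)).
{ apply sqrt_lt_R0. apply Rmult_lt_0_compat; [apply PI_RGT_0 | exact Halpha]. }
(* This [q] solves [q * sqrt (PI * alpha) / k = K]. *)
exists (K * k / sqrt (PI * alpha)), a, b.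
split; [exact Ha|]. split.
- intros t Ht. destruct (Hf t Ht) as [Hs [Hr _]]. now split.
- intros x t Ht Hx. rewrite (HTg x t Ht Hx). unfold erf_temp.
  assert (Hy : 0 < x / (2 * sqrt (alpha * t)) < a).
  { apply similarity_lt; try assumption. destruct (Hf t Ht) as [Hs _]. now rewrite <- Hs. }
  assert (H := Hprof _ Hy).
  replace (K * k / sqrt (PI * alpha) * sqrt (PI * alpha) / k) with K by (field; lra).
  lra.
Qed.

(** * Roots of the two transcendental equations *)

(** Both equations have left side [(x + A * E) * E] with [E] positive and increasing in [x]:
    [exp (x ^ 2)] for the flux problem, [1 / F_infty x] for the temperature problem. *)
Lemma self_product_increasing (A x y E1 E2 : R) :
  0 < A -> 0 < x < y -> 0 < E1 < E2 -> (x + A * E1) * E1 < (y + A * E2) * E2.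
Proof.
intros HA Hxy HE.
assert (A * E1 < A * E2) by (apply Rmult_lt_compat_l; lra).
assert (0 < A * E1) by (apply Rmult_lt_0_compat; lra).
apply Rmult_le_0_lt_compat; lra.
Qed.

Lemma exp_sqr_increasing (x y : R) : 0 < x < y -> exp (x ^ 2) < exp (y ^ 2).
Proof. intros H. apply exp_increasing. nra. Qed.

Lemma root_P3_inj (k rho c ell gamma eps q x y : R) :
  let alpha := k / (rho * c) in
  0 < k -> 0 < alpha -> 0 < gamma -> eps < 1 -> 0 < q ->
  root_P3 k rho c ell gamma eps q x -> root_P3 k rho c ell gamma eps q y -> x = y.
Proof.
intros alpha Hk Halpha Hgamma Heps Hq [Hx Ex] [Hy Ey]. fold alpha in Ex, Ey.
rewrite <- Ey in Ex. clear Ey. revert Ex.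
assert (Hs := sqrt_lt_R0 _ Halpha).
set (A := gamma * (1 - eps) * k / (2 * q * sqrt alpha)). intros Ex.
assert (HA : 0 < A).
{ unfold A. apply Rdiv_lt_0_compat; repeat apply Rmult_lt_0_compat; lra. }
assert (Hex := exp_pos (x ^ 2)). assert (Hey := exp_pos (y ^ 2)).
destruct (Rtotal_order x y) as [H|[H|H]]; [|exact H|]; exfalso.
- assert (H1 := exp_sqr_increasing x y (conj Hx H)).
  assert (H2 := self_product_increasing A x y _ _ HA (conj Hx H) (conj Hex H1)). lra.
- assert (H1 := exp_sqr_increasing y x (conj Hy H)).
  assert (H2 := self_product_increasing A y x _ _ HA (conj Hy H) (conj Hey H1)). lra.
Qed.

Lemma inv_F_infty (x : R) : 0 < x -> 1 / F_infty x = erf x * exp (x ^ 2).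
Proof.
intros Hx. unfold F_infty. rewrite exp_Ropp.
assert (H := erf_pos x Hx). assert (He := exp_pos (x ^ 2)). field. split; lra.
Qed.

Lemma inv_F_infty_increasing (x y : R) : 0 < x < y ->
  0 < 1 / F_infty x < 1 / F_infty y.
Proof.
intros Hxy. rewrite !inv_F_infty by lra.
assert (H0 := erf_pos x). assert (H1 := erf_increasing x y).
assert (H2 := exp_sqr_increasing x y Hxy). assert (He := exp_pos (x ^ 2)).
split; [apply Rmult_lt_0_compat | apply Rmult_le_0_lt_compat]; lra.
Qed.

Lemma G2_increasing (gamma eps D0 x y : R) :
  0 < gamma -> eps < 1 -> 0 < D0 -> 0 < x < y -> G2 gamma eps D0 x < G2 gamma eps D0 y.
Proof.
intros Hgamma Heps HD Hxy. unfold G2. rewrite !(Rmult_comm (1 / F_infty _) (_ + _)).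
apply self_product_increasing; [|exact Hxy|now apply inv_F_infty_increasing].
assert (H := sqrt_PI_pos). apply Rdiv_lt_0_compat; repeat apply Rmult_lt_0_compat; lra.
Qed.

Lemma root_P2_inj (c ell gamma eps D0 x y : R) :
  0 < gamma -> eps < 1 -> 0 < D0 ->
  root_P2 c ell gamma eps D0 x -> root_P2 c ell gamma eps D0 y -> x = y.
Proof.
intros Hgamma Heps HD [Hx Ex] [Hy Ey]. rewrite <- Ey in Ex.
destruct (Rtotal_order x y) as [H|[H|H]]; [|exact H|]; exfalso.
- assert (G2 gamma eps D0 x < G2 gamma eps D0 y) by (apply G2_increasing; lra). lra.
- assert (G2 gamma eps D0 y < G2 gamma eps D0 x) by (apply G2_increasing; lra). lra.
Qed.

(** With [D0] computed from the same [x], each side of the second equation is [erf x] times the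
    corresponding side of the first, and [erf x > 0]. *)
Lemma root_P3_iff_root_P2 (k rho c ell gamma eps q x : R) :
  let alpha := k / (rho * c) in
  0 < k -> 0 < rho -> 0 < c -> 0 < ell -> 0 < q -> 0 < x ->
  (root_P3 k rho c ell gamma eps q x <->
   root_P2 c ell gamma eps (q * sqrt (PI * alpha) / k * erf x) x).
Proof.
intros alpha Hk Hrho Hc Hell Hq Hx.
assert (Halpha : 0 < alpha) by (apply Rdiv_lt_0_compat; nra).
assert (HPI := PI_RGT_0). assert (Hpi := sqrt_PI_pos).
assert (Hs := sqrt_lt_R0 _ Halpha). assert (Herf := erf_pos x Hx).
assert (HB : q * sqrt (PI * alpha) / k * erf x * c / (ell * sqrt PI) =
  erf x * (q / (rho * ell * sqrt alpha))).
{ rewrite sqrt_mult by lra.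
  replace (q / (rho * ell * sqrt alpha)) with (q * sqrt alpha * c / (ell * k)).
  - field. lra.
  (* The definition of [alpha] enters here: it trades [c * sqrt alpha / k] for
     [1 / (rho * sqrt alpha)]. *)
  - assert (Hsq : sqrt alpha * sqrt alpha * (rho * c) = k).
    { rewrite sqrt_sqrt by lra. unfold alpha. field. lra. }
    rewrite <- Hsq. field. lra. }
assert (HG : G2 gamma eps (q * sqrt (PI * alpha) / k * erf x) x =
  erf x * ((x + gamma * (1 - eps) * k / (2 * q * sqrt alpha) * exp (x ^ 2)) * exp (x ^ 2))).
{ unfold G2. rewrite inv_F_infty by exact Hx. rewrite sqrt_mult by lra.
  field. lra. }
unfold root_P3, root_P2. fold alpha. rewrite HB, HG.
split; intros [_ H]; split; try exact Hx.
- now rewrite H.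
- apply Rmult_eq_reg_l with (erf x); lra.
Qed.

(** The mushy-width equation is linear in [b] and gives [b = nu_P3]; substituting this in the energy
    balance leaves the equation for [a]. *)
Lemma front_system_iff_root_P3 (k rho c ell gamma eps q a b : R) :
  let alpha := k / (rho * c) in
  0 < k -> 0 < alpha -> 0 < rho -> 0 < ell -> 0 < q -> 0 < a ->
  (front_system k alpha rho ell gamma eps q a b <->
   b = nu_P3 k alpha gamma q a /\ root_P3 k rho c ell gamma eps q a).
Proof.
intros alpha Hk Halpha Hrho Hell Hq Ha.
assert (Hs := sqrt_lt_R0 _ Halpha). assert (He := exp_pos (a ^ 2)).
unfold front_system, root_P3, nu_P3. fold alpha. rewrite exp_Ropp.
set (E := exp (a ^ 2)) in *. set (A := sqrt alpha) in *.
assert (HqA : 0 < 2 * q * A) by (repeat apply Rmult_lt_0_compat; lra).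
assert (HrA : 0 < rho * ell * A) by (repeat apply Rmult_lt_0_compat; lra).
split.
- intros [H1 H2].
  assert (Hb : b = a + gamma * k / (2 * q * A) * E) by (rewrite <- H1; field; lra).
  split; [exact Hb|]. split; [exact Ha|].
  (* Only the [q] on the right-hand side is replaced; the one inside the coefficient of [E]
     stays. *)
  replace q with (rho * ell * A * (eps * a + (1 - eps) * b) * E) at 2
    by (rewrite <- H2; field; lra).
  rewrite Hb. field. lra.
- intros [Hb [_ H]]. split.
  + rewrite Hb. field. lra.
  + assert (Hq' : q = rho * ell * A * ((a + gamma * (1 - eps) * k / (2 * q * A) * E) * E)).
    { rewrite H. field. lra. }
    rewrite Hb. rewrite Hq' at 1. field. lra.
Qed.

(** Intermediate values: at [0] the left side is [A], and the bound on [q0] says exactly that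
    [A < B]; the left side exceeds [B] at [B + 1]. *)
Lemma root_P3_exists (k rho c ell gamma eps q0 : R) :
  0 < k -> 0 < rho -> 0 < c -> 0 < ell -> 0 < gamma -> 0 < q0 -> eps < 1 ->
  sqrt (gamma * (1 - eps) * rho * ell * k / 2) < q0 ->
  exists omega, root_P3 k rho c ell gamma eps q0 omega.
Proof.
intros Hk Hrho Hc Hell Hgamma Hq0 Heps Hq.
unfold root_P3.
assert (Halpha : 0 < k / (rho * c)) by (apply Rdiv_lt_0_compat; nra).
assert (Hs := sqrt_lt_R0 _ Halpha).
set (S := sqrt (k / (rho * c))) in *.
set (A := gamma * (1 - eps) * k / (2 * q0 * S)).
set (B := q0 / (rho * ell * S)).
assert (HA : 0 < A).
{ unfold A. apply Rdiv_lt_0_compat; repeat apply Rmult_lt_0_compat; lra. }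
assert (HAB : A < B).
{ assert (HX : 0 <= gamma * (1 - eps) * rho * ell * k / 2).
  { assert (0 < gamma * (1 - eps) * rho * ell * k) by (repeat apply Rmult_lt_0_compat; lra).
    lra. }
  assert (Hsq : gamma * (1 - eps) * rho * ell * k / 2 < q0 * q0).
  { rewrite <- (sqrt_sqrt _ HX). assert (H0 := sqrt_pos (gamma * (1 - eps) * rho * ell * k / 2)).
    apply Rmult_le_0_lt_compat; lra. }
  (* This factor clears both denominators, so that [A < B] becomes the squared hypothesis. *)
  apply Rmult_lt_reg_r with (q0 * rho * ell * S).
  - repeat apply Rmult_lt_0_compat; lra.
  - replace (A * (q0 * rho * ell * S)) with (gamma * (1 - eps) * rho * ell * k / 2)
      by (unfold A; field; lra).
    replace (B * (q0 * rho * ell * S)) with (q0 * q0) by (unfold B; field; lra).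
    exact Hsq. }
destruct (IVT (fun x => (x + A * exp (x ^ 2)) * exp (x ^ 2) - B) 0 (B + 1)) as [z [[Hz _] Ez]].
- intros x. apply continuity_pt_filterlim.
  apply (ex_derive_continuous (fun x => (x + A * exp (x ^ 2)) * exp (x ^ 2) - B)).
  auto_derive. exact I.
- lra.
- replace (0 ^ 2) with 0 by ring. rewrite exp_0. lra.
- assert (H1 := exp_ineq1_le ((B + 1) ^ 2)). nra.
- exists z. split; [|lra].
  (* The theorem only gives [0 <= z]; the endpoint is excluded since the function equals [A - B < 0]
     there. *)
  destruct Hz as [Hz|Hz]; [exact Hz|exfalso]. subst z.
  replace (0 ^ 2) with 0 in Ez by ring. rewrite exp_0 in Ez. lra.
Qed.

(** * Explicit solutions and equivalence of the two problems *)

Lemma nu_P3_gt (k alpha gamma q a : R) :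
  0 < k -> 0 < alpha -> 0 < gamma -> 0 < q -> a < nu_P3 k alpha gamma q a.
Proof.
intros Hk Halpha Hgamma Hq. unfold nu_P3.
assert (Hs := sqrt_lt_R0 _ Halpha). assert (He := exp_pos (a ^ 2)).
assert (0 < gamma * k / (2 * q * sqrt alpha) * exp (a ^ 2)); [|lra].
apply Rmult_lt_0_compat; [|lra].
apply Rdiv_lt_0_compat; repeat apply Rmult_lt_0_compat; lra.
Qed.

(** The factor [erf a] of [D0] cancels the one in [mu_P2]. *)
Lemma mu_P2_nu_P3 (k alpha gamma q a : R) : 0 < k -> 0 < alpha -> 0 < q -> 0 < a ->
  mu_P2 gamma (q * sqrt (PI * alpha) / k * erf a) a = nu_P3 k alpha gamma q a.
Proof.
intros Hk Halpha Hq Ha. unfold mu_P2, nu_P3.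
assert (HPI := PI_RGT_0). assert (Hpi := sqrt_PI_pos).
assert (Hs := sqrt_lt_R0 _ Halpha). assert (Herf := erf_pos a Ha).
rewrite sqrt_mult by lra. field. lra.
Qed.

Lemma temp_P3_erf_temp (k alpha q a x t : R) : 0 < k -> 0 < a ->
  temp_P3 k alpha q a x t = erf_temp k alpha q a x t.
Proof.
intros Hk Ha. unfold temp_P3, erf_temp. assert (H := erf_pos a Ha). field. lra.
Qed.

Lemma temp_P2_temp_P3 (k alpha q a x t : R) : 0 < k -> 0 < a ->
  temp_P2 alpha (q * sqrt (PI * alpha) / k * erf a) a x t = temp_P3 k alpha q a x t.
Proof.
intros Hk Ha. unfold temp_P2, temp_P3. assert (H := erf_pos a Ha). field. lra.
Qed.

(** One erf profile meets both face conditions. [T] is kept general so that the result applies to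
    [temp_P3] and [temp_P2] alike. *)
Lemma solves_P3_P2_of_root (k rho c ell gamma eps q a : R) (T : R -> R -> R) :
  let alpha := k / (rho * c) in
  let b := nu_P3 k alpha gamma q a in
  0 < k -> 0 < alpha -> 0 < rho -> 0 < ell -> 0 < gamma -> 0 < q ->
  root_P3 k rho c ell gamma eps q a ->
  (forall x t, T x t = erf_temp k alpha q a x t) ->
  solves_P3 k rho c ell gamma eps q T (front alpha a) (front alpha b) /\
  solves_P2 k rho c ell gamma eps (q * sqrt (PI * alpha) / k * erf a)
    T (front alpha a) (front alpha b).
Proof.
intros alpha b Hk Halpha Hrho Hell Hgamma Hq Hroot HT.
assert (Ha : 0 < a) by apply Hroot.
assert (Hsol : erf_solution k alpha q a b T (front alpha a) (front alpha b)).
{ repeat split; auto. }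
assert (HC : common_conditions k rho c ell gamma eps T (front alpha a) (front alpha b)).
{ apply common_conditions_of_system with q; try assumption.
  - now apply nu_P3_gt.
  - now apply front_system_iff_root_P3. }
split; split; try exact HC; intros t Ht.
- now apply (erf_solution_face_flux k alpha q a b q T (front alpha a) (front alpha b)).
- now apply (erf_solution_face_temperature k alpha q a b _ T (front alpha a) (front alpha b)).
Qed.

(* The mushy-width condition forces [q > 0], whatever the condition imposed at [x = 0]. *)
Lemma erf_solution_root (k rho c ell gamma eps : R)
    (T : R -> R -> R) (s r : R -> R) :
  let alpha := k / (rho * c) in
  0 < k -> 0 < alpha -> 0 < rho -> 0 < ell -> 0 < gamma ->
  self_similar alpha T s r -> common_conditions k rho c ell gamma eps T s r ->
  exists q a b, 0 < q /\ erf_solution k alpha q a b T s r /\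
    root_P3 k rho c ell gamma eps q a.
Proof.
intros alpha Hk Halpha Hrho Hell Hgamma Hss HC.
destruct (erf_solution_of_self_similar k rho c ell gamma eps T s r Hk Halpha Hss HC)
  as [q [a [b Hsol]]].
destruct (front_system_of_erf_solution k rho c ell gamma eps q a b T s r Hk Halpha Hsol HC)
  as [Hsys Hab].
assert (Hs := sqrt_lt_R0 _ Halpha).
assert (Hq : 0 < q).
{ destruct Hsys as [H _]. fold alpha in H.
  assert (Hgk : 0 < gamma * k) by now apply Rmult_lt_0_compat.
  assert (Hp : 0 < 2 * sqrt alpha * (b - a) * exp (- a ^ 2)).
  { assert (He := exp_pos (- a ^ 2)). repeat apply Rmult_lt_0_compat; lra. }
  apply Rmult_lt_reg_r with (2 * sqrt alpha * (b - a) * exp (- a ^ 2)); [exact Hp|].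
  rewrite Rmult_0_l. rewrite <- H in Hgk. lra. }
exists q, a, b. split; [exact Hq|]. split; [exact Hsol|].
apply (front_system_iff_root_P3 k rho c ell gamma eps q a b); try assumption.
apply Hsol.
Qed.

Theorem theorem7 (k rho c ell gamma q0 eps : R)
    (hk : 0 < k) (hrho : 0 < rho) (hc : 0 < c) (hell : 0 < ell)
    (hgamma : 0 < gamma) (hq0 : 0 < q0) (heps : 0 < eps < 1)
    (hq : q0 > sqrt (gamma * (1 - eps) * rho * ell * k / 2)) :
  let alpha := k / (rho * c) in
  (exists! omega : R, root_P3 k rho c ell gamma eps q0 omega) /\
  forall omega D0 : R,
    D0 = q0 * sqrt (PI * alpha) / k * erf omega ->
    root_P3 k rho c ell gamma eps q0 omega \/
      root_P2 c ell gamma eps D0 omega ->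
    0 < D0 /\
    unique (root_P3 k rho c ell gamma eps q0) omega /\
    unique (root_P2 c ell gamma eps D0) omega /\
    (forall xi : R, root_P2 c ell gamma eps D0 xi ->
      let T3 := temp_P3 k alpha q0 omega in
      let s3 := front alpha omega in
      let r3 := front alpha (nu_P3 k alpha gamma q0 omega) in
      let T2 := temp_P2 alpha D0 xi in
      let s2 := front alpha xi in
      let r2 := front alpha (mu_P2 gamma D0 xi) in
      solves_P3 k rho c ell gamma eps q0 T3 s3 r3 /\
      solves_P2 k rho c ell gamma eps D0 T2 s2 r2 /\
      coincide T3 s3 r3 T2 s2 r2) /\
    (forall (T : R -> R -> R) (s r : R -> R),
      self_similar alpha T s r ->
      (solves_P3 k rho c ell gamma eps q0 T s r <->
       solves_P2 k rho c ell gamma eps D0 T s r)).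
Proof.
intros alpha.
destruct heps as [_ heps].
assert (Halpha : 0 < alpha) by (apply Rdiv_lt_0_compat; nra).
assert (Hamp : 0 < sqrt (PI * alpha) / k).
{ apply Rdiv_lt_0_compat; [|exact hk].
  apply sqrt_lt_R0, Rmult_lt_0_compat; [apply PI_RGT_0 | exact Halpha]. }
assert (Hinj3 := fun x y => root_P3_inj k rho c ell gamma eps q0 x y hk Halpha hgamma heps hq0).
split.
{ destruct (root_P3_exists k rho c ell gamma eps q0) as [w Hw]; try assumption.
  exists w. split; [exact Hw|]. intros y Hy. now apply Hinj3. }
intros omega D0 HD Hroot.
assert (Homega : 0 < omega) by (destruct Hroot as [[H _]|[H _]]; exact H).
assert (Herf := erf_pos omega Homega).
assert (HD0 : 0 < D0).
{ rewrite HD. apply Rmult_lt_0_compat; [|exact Herf].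
  unfold Rdiv. rewrite Rmult_assoc. now apply Rmult_lt_0_compat. }
assert (Hiff := root_P3_iff_root_P2 k rho c ell gamma eps q0 omega hk hrho hc hell hq0 Homega).
fold alpha in Hiff. rewrite <- HD in Hiff.
(* Whichever equation [omega] is assumed to solve, [Hiff] supplies the other. *)
assert (H3 : root_P3 k rho c ell gamma eps q0 omega) by tauto.
assert (H2 : root_P2 c ell gamma eps D0 omega) by tauto.
assert (Hinj2 := fun x y => root_P2_inj c ell gamma eps D0 x y hgamma heps HD0).
split; [exact HD0|]. split; [|split; [|split]].
- split; [exact H3|]. intros y Hy. now apply Hinj3.
- split; [exact H2|]. intros y Hy. now apply Hinj2.
- intros xi Hxi. assert (xi = omega) by now apply Hinj2. subst xi. cbv zeta.
  assert (Hsol := fun T => solves_P3_P2_of_root k rho c ell gamma eps q0 omega T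
    hk Halpha hrho hell hgamma hq0 H3).
  fold alpha in Hsol. rewrite <- HD in Hsol.
  assert (Hmu : mu_P2 gamma D0 omega = nu_P3 k alpha gamma q0 omega)
    by (rewrite HD; now apply mu_P2_nu_P3).
  assert (HT : forall x t, temp_P2 alpha D0 omega x t = temp_P3 k alpha q0 omega x t)
    by (intros x t; rewrite HD; now apply temp_P2_temp_P3).
  rewrite Hmu. split; [|split].
  + apply Hsol. intros x t. now apply temp_P3_erf_temp.
  + apply Hsol. intros x t. rewrite HT. now apply temp_P3_erf_temp.
  + split; [now split|]. intros x t _ _. symmetry. apply HT.
- intros T s r Hss.
  split; intros [HC Hface]; split; try exact HC; intros t Ht;
    specialize (Hface t Ht);
    destruct (erf_solution_root k rho c ell gamma eps T s r hk Halpha hrho hell hgamma Hss HC)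
      as [q [a [b [Hq [Hsol Hra]]]]];
    fold alpha in Hsol.
  (* The flux gives [q = q0] at once, then uniqueness of the root gives [a = omega]. *)
  + apply (erf_solution_face_flux k alpha q a b q0 T s r t hk Halpha Hsol Ht) in Hface.
    subst q.
    assert (a = omega) by now apply Hinj3. subst a.
    apply (erf_solution_face_temperature k alpha q0 omega b D0 T s r); auto.
  (* Here [q] is not yet known: the temperature fixes only its product with [erf a]. Passing to the
     second equation, which contains only [D0], gives [a = omega] first; comparing the two
     expressions of [D0] then gives [q = q0]. *)
  + apply (erf_solution_face_temperature k alpha q a b D0 T s r t hk Halpha Hsol Ht) in Hface.
    assert (Ha : 0 < a) by apply Hra.
    apply (root_P3_iff_root_P2 k rho c ell gamma eps q a) in Hra; try assumption.
    fold alpha in Hra. rewrite Hface in Hra.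
    assert (a = omega) by now apply Hinj2. subst a.
    apply (erf_solution_face_flux k alpha q omega b q0 T s r); try assumption.
    apply Rmult_eq_reg_r with (sqrt (PI * alpha) / k * erf omega).
    * rewrite HD in Hface. unfold Rdiv in *. lra.
    * apply Rgt_not_eq. now apply Rmult_lt_0_compat.
Qed.
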